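(* Let $T$ be a tree verifying the following properties: (T1) every node of $T$ has infinitely many immediate successors; (T2) for any countable family of antichains $\{S_n : n<\omega\}$ of $T$ there exists $t\in T$ such that $t\not\in\bigcup_{n<\omega}\hat{S}_n$. Then there is neither a strictly convex nor a Kadec equivalent norm in $JT^\ast$.
   Context: A tree is a partially ordered set $(T,\prec)$ such that for every $t\in T$ the set $\{s\in T : s\prec t\}$ is well ordered by $\prec$. An antichain is a subset any two different elements of which are incomparable. The downwards closure of $S\subset T$ is $\hat S=\{t\in T : \exists s\in S,\ t\preceq s\}$. An immediate successor of $t$ is a node $s\succ t$ with no node strictly between $t$ and $s$. A chain is a totally ordered subset of $T$; a segment is a chain $\sigma$ such that whenever $s\prec t\prec u$ and $s,u\in\sigma$, then $t\in\sigma$. The James tree space $JT$ is the completion of $c_{00}(T)=\{f\in\mathbb{R}^T : f \text{ has finite support}\}$ under the norm $\|f\| = \sup \left(\sum_{i=1}^n \left(\sum_{t\in \sigma_i}f(t)\right)^2\right)^{1/2}$, the supremum running over all finite families of pairwise disjoint segments $\sigma_1,\ldots,\sigma_n$ of $T$. A norm is strictly convex if its unit sphere contains no nondegenerate segment; it is a Kadec norm if the weak topology and the norm topology coincide on its unit sphere. *)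

(* Defs.v *)
From HB Require Import structures.
From mathcomp Require Import all_boot all_order all_algebra.
From mathcomp Require Import all_classical all_reals all_analysis.
From mathcomp Require wochoice.
From mathcomp Require Import ring lra.

Set Implicit Arguments.
Unset Strict Implicit.
Unset Printing Implicit Defensive.

Import Order.TTheory GRing.Theory Num.Theory.
Import numFieldNormedType.Exports.

Local Open Scope classical_set_scope.
Local Open Scope ring_scope.

Section trees.
Context {d : Order.disp_t} {T : porderType d}.
Implicit Types (s t u : T) (S : set T).

Definition is_tree := forall t, wochoice.wo_chain (<=%O : rel T) [pred s | (s < t)%O].

Definition antichain S :=
  forall s t, S s -> S t -> s <> t -> ~ (s >=< t)%O.

Definition down_closure S : set T := [set t | exists2 s, S s & (t <= s)%O].

Definition immediate_succ t s := (t < s)%O /\ ~ exists u, (t < u < s)%O.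

Definition segment S := total_on S (<=%O : rel T) /\
  forall s t u, S s -> S u -> (s < t < u)%O -> S t.

Lemma segment1 t : segment [set t].
Proof.
split=> [s u -> -> | s t' u -> ->]; first by left.
by move=> /andP[/lt_trans /[apply]]; rewrite ltxx.
Qed.

End trees.
Arguments is_tree {d} T.

Section c00.
Context (R : realType) {d : Order.disp_t} (T : porderType d).

Definition finsupp_fun : {pred (T -> R^o)} :=
  fun f => `[< finite_set [set t | f t != 0] >].

Record c00 := C00 { c00_fun :> T -> R^o; _ : c00_fun \in finsupp_fun }.

HB.instance Definition _ := [isSub for c00_fun].
HB.instance Definition _ := [Choice of c00 by <:].

Lemma finsupp_fun_submod : submod_closed finsupp_fun.
Proof.
split.
  apply/asboolP; apply: (sub_finite_set _ (finite_set0 _)) => t /=.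
  by rewrite eqxx.
move=> a f g /asboolP ff /asboolP gf; apply/asboolP.
have fg : finite_set ([set t | f t != 0] `|` [set t | g t != 0]).
  by rewrite finite_setU.
apply: (sub_finite_set _ fg) => t /=.
have -> : (a *: f + g) t = a * f t + g t by [].
have [->|f0 _] := eqVneq (f t) 0; last by left.
have [->|g0 _] := eqVneq (g t) 0; last by right.
by rewrite mulr0 addr0 eqxx.
Qed.

HB.instance Definition _ :=
  GRing.isSubmodClosed.Build R (T -> R^o) finsupp_fun finsupp_fun_submod.
HB.instance Definition _ := [SubChoice_isSubLmodule of c00 by <:].

Implicit Types (f g : c00) (n : nat).

Lemma c00_finite f : finite_set [set t | f t != 0].
Proof. by case: f => f /= /asboolP. Qed.

Definition l2_of_sums f n (sigma : 'I_n -> set T) : R :=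
  Num.sqrt (\sum_(i < n) (\sum_(t \in sigma i) (f t : R)) ^+ 2).

Definition disjoint_segments n (sigma : 'I_n -> set T) :=
  (forall i, segment (sigma i)) /\ trivIset [set: 'I_n] sigma.

Definition JT_sums f : set R :=
  [set r | exists n (sigma : 'I_n -> set T),
     disjoint_segments sigma /\ r = l2_of_sums f sigma].

(* Always a real supremum, see [JT_sums_ubound] and [JT_sums_nonempty]. *)
Definition JT_norm f : R := sup (JT_sums f).

Lemma sum_c00E f (A : set T) (r : seq T) : uniq r ->
    [set t | f t != 0] `<=` [set` r] ->
  \sum_(t \in A) (f t : R) = \sum_(t <- r) (if t \in A then f t : R else 0).
Proof.
move=> ur fr; rewrite (fsbig_seq _ _ ur) -fsbig_mkcondr; apply/esym/fsbig_widen.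
  by move=> t [].
move=> t [/= At tr]; have [//|ft] := eqVneq (f t) 0.
by case: tr; split => //; exact: fr.
Qed.

Lemma c00_common_seq f g : exists r : seq T, [/\ uniq r,
  [set t | f t != 0] `<=` [set` r] & [set t | g t != 0] `<=` [set` r]].
Proof.
have /finite_seqP[s sE] : finite_set ([set t | f t != 0] `|` [set t | g t != 0]).
  by rewrite finite_setU; split; exact: c00_finite.
exists (undup s); split; first exact: undup_uniq.
- move=> t ft; have : [set` s] t by rewrite -sE; left.
  by rewrite /= mem_undup.
- move=> t gt; have : [set` s] t by rewrite -sE; right.
  by rewrite /= mem_undup.
Qed.

Lemma c00DE f g t : (f + g) t = f t + g t. Proof. by []. Qed.

Lemma c00ZE (a : R) f t : (a *: f) t = a * f t. Proof. by []. Qed.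

Lemma sum_c00D f g (A : set T) : \sum_(t \in A) ((f + g) t : R) =
  \sum_(t \in A) (f t : R) + \sum_(t \in A) (g t : R).
Proof.
have [r [ur fr gr]] := c00_common_seq f g.
rewrite (sum_c00E A ur fr) (sum_c00E A ur gr) (@sum_c00E (f + g) A r)//.
  by rewrite -big_split; apply: eq_bigr => t _ /=; case: ifP; rewrite ?addr0.
move=> t; have [ft|ft _] := eqVneq (f t) 0; last exact: fr.
have [gt|gt _] := eqVneq (g t) 0; last exact: gr.
by rewrite /mkset c00DE ft gt addr0 eqxx.
Qed.

Lemma sum_c00Z (a : R) f (A : set T) : \sum_(t \in A) ((a *: f) t : R) =
  a * \sum_(t \in A) (f t : R).
Proof.
have [r [ur fr _]] := c00_common_seq f f.
rewrite (sum_c00E A ur fr) (@sum_c00E (a *: f) A r)//.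
  by rewrite mulr_sumr; apply: eq_bigr => t _; case: ifP; rewrite ?mulr0.
move=> t; have [ft|ft _] := eqVneq (f t) 0; last exact: fr.
by rewrite /mkset c00ZE ft mulr0 eqxx.
Qed.

Lemma l2_minkowski n (a b : 'I_n -> R) :
  Num.sqrt (\sum_(i < n) (a i + b i) ^+ 2) <=
  Num.sqrt (\sum_(i < n) a i ^+ 2) + Num.sqrt (\sum_(i < n) b i ^+ 2).
Proof.
set A := \sum_(i < n) a i ^+ 2; set B := \sum_(i < n) b i ^+ 2.
pose S := \sum_(i < n) a i * b i.
have A0 : 0 <= A by apply: sumr_ge0 => i _; exact: sqr_ge0.
have B0 : 0 <= B by apply: sumr_ge0 => i _; exact: sqr_ge0.
have E : \sum_(i < n) (a i + b i) ^+ 2 = A + 2 * S + B.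
  rewrite /A /B /S mulr_sumr -!big_split/=; apply: eq_bigr => i _; ring.
have CS : S ^+ 2 <= A * B.
  have H : 0 <= B * (A * B - S ^+ 2).
    have -> : B * (A * B - S ^+ 2) = \sum_(i < n) (B * a i - S * b i) ^+ 2.
      transitivity (B ^+ 2 * A - 2 * B * S * S + S ^+ 2 * B); first by ring.
      have -> : B ^+ 2 * A = \sum_(i < n) B ^+ 2 * a i ^+ 2.
        by rewrite mulr_sumr.
      have -> : S ^+ 2 * B = \sum_(i < n) S ^+ 2 * b i ^+ 2.
        by rewrite mulr_sumr.
      have -> : 2 * B * S * S = \sum_(i < n) 2 * B * S * (a i * b i).
        by rewrite -mulr_sumr.
      rewrite -sumrN -!big_split/=.
      by apply: eq_bigr => i _; ring.
    by apply: sumr_ge0 => i _; exact: sqr_ge0.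
  have [B1|B1] := eqVneq B 0; last first.
    by rewrite -subr_ge0 -(pmulr_rge0 _ (_ : 0 < B)) // lt0r B1.
  have b0 i : b i = 0.
    move/eqP: B1; rewrite psumr_eq0 => [|j _]; last exact: sqr_ge0.
    by move/allP => /(_ i); rewrite mem_index_enum sqrf_eq0 => /(_ isT) /eqP.
  by rewrite /S big1 ?expr0n ?mulr_ge0// => i _; rewrite b0 mulr0.
have S1 : S <= Num.sqrt A * Num.sqrt B.
  rewrite -sqrtrM// (le_trans (ler_norm _))// -sqrtr_sqr ler_wsqrtr//.
rewrite -[leRHS]ger0_norm ?addr_ge0 ?sqrtr_ge0// -sqrtr_sqr ler_wsqrtr// E.
rewrite sqrrD !sqr_sqrtr// lerD2r lerD2l -[leRHS]mulr_natl.
by rewrite ler_pM2l.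
Qed.

Lemma l2_le_l1 n (a : 'I_n -> R) :
  Num.sqrt (\sum_(i < n) a i ^+ 2) <= \sum_(i < n) `|a i|.
Proof.
elim: n a => [|n IH] a; first by rewrite !big_ord0 sqrtr0.
rewrite !big_ord_recl/=; set B := \sum_(i < n) _ ^+ 2.
have B0 : 0 <= B by apply: sumr_ge0 => i _; exact: sqr_ge0.
apply: (le_trans _ (lerD (lexx `|a ord0|) (IH (fun i => a (lift ord0 i))))).
rewrite -/B -[leRHS]ger0_norm ?addr_ge0 ?sqrtr_ge0// -sqrtr_sqr ler_wsqrtr//.
rewrite sqrrD sqr_sqrtr// real_normK ?num_real// lerD2r lerDl.
by rewrite mulrn_wge0// mulr_ge0// sqrtr_ge0.
Qed.

Lemma JT_sums_ubound f : has_ubound (JT_sums f).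
Proof.
have [r [ur fr _]] := c00_common_seq f f.
exists (\sum_(t <- r) `|f t : R|) => _ [n [sigma [[_ tsigma] ->]]].
apply: (le_trans (l2_le_l1 _)).
apply: (@le_trans _ _
  (\sum_(i < n) \sum_(t <- r) (if t \in sigma i then `|f t : R| else 0))).
  apply: ler_sum => i _; rewrite (sum_c00E _ ur fr).
  apply: (le_trans (ler_norm_sum _ _ _)); apply: ler_sum => t _.
  by case: ifP => //; rewrite normr0.
rewrite exchange_big/=; apply: ler_sum => t _.
have [[i ti]|nt] := pselect (exists i, sigma i t); last first.
  rewrite big1// => i _; case: ifPn => //; rewrite inE => ti.
  by case: nt; exists i.
rewrite (bigD1 i)//= mem_set// big1 ?addr0// => j ji.
case: ifPn => //; rewrite inE => tj; case/negP: ji; apply/eqP.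
by apply: tsigma => //; exists t.
Qed.

Lemma JT_sums_le f n (sigma : 'I_n -> set T) :
  disjoint_segments sigma -> l2_of_sums f sigma <= JT_norm f.
Proof.
by move=> ds; apply: (ub_le_sup (JT_sums_ubound f)); exists n, sigma.
Qed.

Lemma JT_sums_nonempty f : JT_sums f !=set0.
Proof.
exists (l2_of_sums f (fun _ : 'I_0 => set0)), 0%N, (fun=> set0).
by split=> //; split=> [[]//|]; exact: trivIset_set0.
Qed.

Lemma JT_normD f g : JT_norm (f + g) <= JT_norm f + JT_norm g.
Proof.
apply: (ge_sup (JT_sums_nonempty _)) => _ [n [sigma [ds ->]]].
apply: le_trans (lerD (JT_sums_le f ds) (JT_sums_le g ds)).
rewrite /l2_of_sums; under eq_bigr do rewrite sum_c00D.
exact: l2_minkowski.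
Qed.

Lemma l2_of_sumsZ (a : R) f n (sigma : 'I_n -> set T) :
  l2_of_sums (a *: f) sigma = `|a| * l2_of_sums f sigma.
Proof.
rewrite /l2_of_sums; under eq_bigr do rewrite sum_c00Z exprMn.
by rewrite -mulr_sumr sqrtrM ?sqr_ge0// sqrtr_sqr.
Qed.

Lemma JT_normZ_le (a : R) f : JT_norm (a *: f) <= `|a| * JT_norm f.
Proof.
apply: (ge_sup (JT_sums_nonempty _)) => _ [n [sigma [ds ->]]].
by rewrite l2_of_sumsZ ler_wpM2l// JT_sums_le.
Qed.

Lemma JT_norm_ge0 f : 0 <= JT_norm f.
Proof.
have [_ [n [sigma [ds _]]]] := JT_sums_nonempty f.
exact: le_trans (sqrtr_ge0 _) (JT_sums_le f ds).
Qed.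

Lemma JT_normZ (a : R) f : JT_norm (a *: f) = `|a| * JT_norm f.
Proof.
apply/eqP; rewrite eq_le JT_normZ_le/=.
have [->|a0] := eqVneq a 0; first by rewrite normr0 mul0r JT_norm_ge0.
rewrite -ler_pdivlMl ?normr_gt0// -normfV.
by have := JT_normZ_le a^-1 (a *: f); rewrite scalerA mulVf// scale1r.
Qed.

Lemma JT_norm_eq0 f : JT_norm f = 0 -> f = 0.
Proof.
move=> f0; apply/val_inj/funext => t /=.
have ds : disjoint_segments (fun _ : 'I_1 => [set t]).
  by split=> [_|i j _ _ _]; [exact: segment1|rewrite !ord1].
have := JT_sums_le f ds; rewrite f0 /l2_of_sums big_ord1 fsbig_set1 sqrtr_sqr.
by rewrite normr_le0 => /eqP.
Qed.

HB.instance Definition _ :=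
  Lmodule_isNormed.Build R c00 JT_normD JT_normZ JT_norm_eq0.

End c00.

Section dual.
Context {R : realType} (E : normedModType R).

Definition continuous_linear : {pred (E -> R^o)} :=
  fun f => `[< linear f /\ continuous f >].

Record dual := Dual { dual_fun :> E -> R^o; _ : dual_fun \in continuous_linear }.

HB.instance Definition _ := [isSub for dual_fun].
HB.instance Definition _ := [Choice of dual by <:].

Lemma continuous_linear_submod : submod_closed continuous_linear.
Proof.
split.
  apply/asboolP; split=> [a x y|x]; last exact: cst_continuous.
  by rewrite /= scaler0 addr0.
move=> a f g /asboolP[lf cf] /asboolP[lg cg]; apply/asboolP; split.
  move=> b x y.
  have E1 z : (a *: f + g) z = a *: f z + g z by [].
  rewrite !E1 lf lg scalerDr !scalerA (mulrC a b) scalerDr !scalerA.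
  by rewrite addrACA.
move=> x; apply: (cvgD _ (cg x)).
exact: (@cvgZl_tmp R R^o E _ _ a f (f x) (cf x)).
Qed.

HB.instance Definition _ :=
  GRing.isSubmodClosed.Build R (E -> R^o) continuous_linear
    continuous_linear_submod.
HB.instance Definition _ := [SubChoice_isSubLmodule of dual by <:].

Implicit Types f g : dual.

Definition unit_values f : set R := [set `|f x| | x in [set x | `|x| <= 1]].

(* The operator norm; the supremum is finite by [unit_values_ubound]. *)
Definition dual_norm f : R := sup (unit_values f).

Lemma dualP f : linear f /\ continuous f.
Proof. by case: f => f /= /asboolP. Qed.

Lemma dualZ f (a : R) x : f (a *: x) = a * f x.
Proof.
have [lf _] := dualP f; have f0 : f 0 = 0.
  by have := lf (-1) 0 0; rewrite scaler0 addr0 scaleN1r addNr.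
by rewrite -[a *: x]addr0 lf f0 addr0.
Qed.

Lemma unit_values_ubound f : has_ubound (unit_values f).
Proof.
have [lf cf] := dualP f.
pose F : {linear E -> R^o} :=
  HB.pack (f : E -> R^o) (GRing.isLinear.Build R E R^o *:%R f lf).
have /linear_boundedP/pinfty_ex_gt0[M M0 fM] :=
  @continuous_linear_bounded _ _ _ 0 F (cf 0).
exists M => _ [x /= x1 <-]; apply: (le_trans (fM x)).
by rewrite ler_piMr// ltW.
Qed.

Lemma unit_values_nonempty f : unit_values f !=set0.
Proof. by exists `|f 0|, 0 => //=; rewrite normr0. Qed.

Lemma dual_norm_ub f x : `|x| <= 1 -> `|f x| <= dual_norm f.
Proof. by move=> x1; apply: (ub_le_sup (unit_values_ubound f)); exists x. Qed.

Lemma dual_normD f g : dual_norm (f + g) <= dual_norm f + dual_norm g.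
Proof.
apply: (ge_sup (unit_values_nonempty _)) => _ [x x1 <-].
exact: le_trans (ler_normD _ _) (lerD (dual_norm_ub f x1) (dual_norm_ub g x1)).
Qed.

Lemma dual_normZ_le (a : R) f : dual_norm (a *: f) <= `|a| * dual_norm f.
Proof.
apply: (ge_sup (unit_values_nonempty _)) => _ [x x1 <-].
have -> : (a *: f) x = a * f x by [].
by rewrite normrM ler_wpM2l// dual_norm_ub.
Qed.

Lemma dual_norm_ge0 f : 0 <= dual_norm f.
Proof. by apply: le_trans (dual_norm_ub f (x := 0) _); rewrite ?normr0. Qed.

Lemma dual_normZ (a : R) f : dual_norm (a *: f) = `|a| * dual_norm f.
Proof.
apply/eqP; rewrite eq_le dual_normZ_le/=.
have [->|a0] := eqVneq a 0; first by rewrite normr0 mul0r dual_norm_ge0.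
rewrite -ler_pdivlMl ?normr_gt0// -normfV.
by have := dual_normZ_le a^-1 (a *: f); rewrite scalerA mulVf// scale1r.
Qed.

Lemma dual_norm_eq0 f : dual_norm f = 0 -> f = 0.
Proof.
move=> f0; apply/val_inj/funext => x /=.
have [->|x0] := eqVneq x 0.
  by rewrite -(scale0r 0) dualZ mul0r.
have : `|f (`|x|^-1 *: x)| <= 0.
  rewrite -f0 dual_norm_ub// normrZ normfV normr_id mulVf// normr_eq0//.
by rewrite dualZ normr_le0 mulf_eq0 invr_eq0 normr_eq0 (negbTE x0) => /eqP.
Qed.

HB.instance Definition _ :=
  Lmodule_isNormed.Build R dual dual_normD dual_normZ dual_norm_eq0.

End dual.

(* A completion of V is unique up to isometric isomorphism over V. *)
Definition completion {R : realType} {V : normedModType R}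
    {E : completeNormedModType R} (iota : {linear V -> E}) :=
  (forall x, `|iota x| = `|x|) /\ dense (range iota).

Section renormings.
Context {R : realType} {X : normedModType R}.
Implicit Types N : X -> R.

(* X with the coarsest topology making every element of [dual X] continuous. *)
Definition weak_space : topologicalType :=
  sup_topology (fun phi : dual X => Topological.class (initial_topology phi)).

(* N is a norm: its definiteness follows from the lower estimate. *)
Definition equivalent_norm N :=
  [/\ forall x y, N (x + y) <= N x + N y,
      forall a x, N (a *: x) = `|a| * N x
    & exists c C, [/\ 0 < c, 0 < C & forall x, c * `|x| <= N x <= C * `|x|]].

Definition sphere N : set X := [set x | N x = 1].

Definition strictly_convex N := forall x y,
  (forall s, 0 <= s <= 1 -> sphere N ((1 - s) *: x + s *: y)) -> x = y.

(* Since N is meant to be an equivalent norm on X, its norm topology is the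
   topology of X. *)
Definition kadec N := forall A : set X, A `<=` sphere N ->
  (exists2 U : set weak_space, open U & A = sphere N `&` U) <->
  (exists2 V : set X, open V & A = sphere N `&` V).

End renormings.
Arguments weak_space {R} X.

(* Main.v *)
From HB Require Import structures.
Require Import Defs.
From mathcomp Require Import all_boot all_order all_algebra.
From mathcomp Require Import all_classical all_reals all_analysis.
From mathcomp Require wochoice.
From mathcomp Require Import ring lra.

Import Order.TTheory GRing.Theory Num.Theory.
Import numFieldNormedType.Exports.

Local Open Scope classical_set_scope.
Local Open Scope ring_scope.

(** Let gamma_t be the functional on JT that sums a vector over the nodes s <= t.
    If s_0, s_1, ... are distinct immediate successors of t and u_k >= s_k, then
    gamma_(u_k) - gamma_t is the sum over the segment ]t, u_k]; these segments are
    pairwise disjoint, so by Cauchy-Schwarz and the definition of the norm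
      |sum_k c_k (gamma_(u_k) - gamma_t)| <= (sum_k c_k^2)^(1/2)
    ([fan_l2_estimate]). Two consequences are used: averages of n such differences
    are O(n^(-1/2)), and gamma_(s_k) converges weakly to gamma_t, although
    |gamma_(s_k) - gamma_t| >= 1 ([branch_dist_ge1]).

    Given an equivalent norm N on the dual, let mu t be the infimum of N over all
    segments [gamma_u, gamma_v] with u, v >= t. This is a nondecreasing function
    of t, and the second hypothesis on the tree plays the part of a Baire category
    theorem: a nondecreasing real function is constant above some node t0
    ([nondecreasing_stabilizes]). Let a be its constant value. For t >= t0 pick in
    each of the cones above the successors s_k of t a competitor whose norm is at
    most a + e. By the estimate above the averages of these competitors converge
    in norm to gamma_t, so N gamma_t <= a + e. Thus N gamma_t <= a for all
    t >= t0, hence N <= a on every segment [gamma_u, gamma_v] with t0 <= u <= v,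
    while N >= a there by definition of mu. So N is equal to a on all these
    segments ([branch_norm_stabilizes]).

    This refutes strict convexity at once, and it refutes the Kadec property since
    gamma_(s_k) -> gamma_t weakly but not in norm, all of them on one sphere. *)

(** * Trees *)

Section trees.
Context {d : Order.disp_t} {T : porderType d}.
Implicit Types (s t u : T) (A : set T).

Lemma tree_comparable (T_tree : is_tree T) s t u :
  (s <= u)%O -> (t <= u)%O -> (s >=< t)%O.
Proof.
rewrite /Order.comparable.
rewrite (le_eqVlt s) (le_eqVlt t) => /predU1P[->|su] /predU1P[->|tu].
- by rewrite lexx.
- by rewrite (ltW tu) orbT.
- by rewrite (ltW su).
- exact: (wochoice.wo_chainW (T_tree u)).
Qed.

Definition minimal_nodes A : set T :=
  [set m | A m /\ forall s, A s -> ~ (s < m)%O].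

Lemma antichain_minimal_nodes A : antichain (minimal_nodes A).
Proof.
move=> s t [As smin] [At tmin] /eqP st.
rewrite /Order.comparable !le_eqVlt (eq_sym t) (negbTE st)/= => /orP[].
- exact: tmin.
- exact: smin.
Qed.

Lemma minimal_node_below (T_tree : is_tree T) A u :
  A u -> exists2 m, minimal_nodes A m & (m <= u)%O.
Proof.
move=> Au.
have [[s [As su]]|nA] := pselect (exists s, A s /\ (s < u)%O); last first.
  by exists u => //; split=> // s As su; apply: nA; exists s.
pose B := [pred s | `[< A s /\ (s < u)%O >]].
have sB : sub_mem (mem B) (mem [pred s | (s < u)%O]).
  by move=> x /asboolP[].
have [|m [[/asboolP[Am mu] mlb] _]] := T_tree u B sB.
  by exists s; apply/asboolP.
exists m; last exact: ltW.
split=> // x Ax xm; have : (m <= x)%O.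
  by apply: mlb; apply/asboolP; split=> //; exact: lt_trans mu.
by move=> /(lt_le_trans xm); rewrite ltxx.
Qed.

(** For each rational q the minimal nodes of {mu > q} form an antichain. Take a
    node t0 outside the downward closures of these countably many antichains. If mu
    exceeded a rational q > mu t0 at some t above t0, the minimal node of {mu > q}
    below t would be comparable to t0, and it can lie neither above t0, by the
    choice of t0, nor below t0, where mu <= mu t0 < q. *)
Lemma nondecreasing_stabilizes (R : realType) (T_tree : is_tree T)
    (T2 : forall S : nat -> set T, (forall n, antichain (S n)) ->
      exists t : T, ~ (\bigcup_n down_closure (S n)) t) (mu : T -> R) :
  {homo mu : s t / (s <= t)%O >-> s <= t} ->
  exists t0, forall t, (t0 <= t)%O -> mu t = mu t0.
Proof.
move=> mu_nd.
pose q n : R := ratr (odflt 0 (@unpickle rat n)).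
have [t0 nt0] := T2 (fun n => minimal_nodes [set t | q n < mu t])
  (fun n => antichain_minimal_nodes _).
exists t0 => t t0t; apply/eqP; rewrite eq_le (mu_nd _ _ t0t) andbT leNgt.
apply/negP => /rat_in_itvoo[r]; rewrite in_itv/= => /andP[rt0 rt].
have qr : q (pickle r) = ratr r by rewrite /q pickleK.
have [|m mmin mt] := @minimal_node_below T_tree [set t | q (pickle r) < mu t] t.
  by rewrite /= qr.
have /orP[mt0|t0m] := tree_comparable T_tree _ _ _ mt t0t.
  have [/= + _] := mmin; rewrite qr => /lt_le_trans /(_ (mu_nd _ _ mt0)).
  by rewrite ltNge (ltW rt0).
by apply: nt0; exists (pickle r) => //; exists m.
Qed.

Lemma segment_initial (T_tree : is_tree T) t : segment [set s | (s <= t)%O].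
Proof.
split=> [s u /= st ut | s x u /= st ut /andP[_ /ltW xu]].
  by apply/orP; exact: tree_comparable st ut.
exact: le_trans ut.
Qed.

Lemma segment_interval (T_tree : is_tree T) t u :
  segment [set s | (t < s <= u)%O].
Proof.
split=> [s x /= /andP[_ su] /andP[_ xu] |
  s x y /= /andP[ts _] /andP[_ yu] /andP[sx xy]].
  by apply/orP; exact: tree_comparable su xu.
by rewrite (lt_trans ts sx) (le_trans (ltW xy) yu).
Qed.

(** A common node x of two of these intervals lies above both of the successors
    concerned, since nothing fits between t and its immediate successors; the two
    are then comparable, hence equal. *)
Lemma trivIset_fan (T_tree : is_tree T) (I : Type) (t : T) (s u : I -> T) :
  injective s -> (forall i, immediate_succ t (s i)) ->
  (forall i, (s i <= u i)%O) ->
  trivIset [set: I] (fun i => [set x | (t < x <= u i)%O]).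
Proof.
move=> s_inj s_succ su i j _ _ [x [/= /andP[tx xi] /andP[_ xj]]].
have le_x k : (x <= u k)%O -> (s k <= x)%O.
  move=> xk; have := tree_comparable T_tree _ _ _ (su k) xk.
  rewrite /Order.comparable (le_eqVlt x) => /orP[//|/predU1P[->//|xs]].
  by case: (s_succ k) => _ []; exists x; rewrite tx xs.
have no_lt k l : ~ (s k < s l)%O.
  by move=> kl; case: (s_succ l) => _ []; exists (s k); rewrite kl (s_succ k).1.
apply: s_inj; have := tree_comparable T_tree _ _ _ (le_x i xi) (le_x j xj).
rewrite /Order.comparable !le_eqVlt => /orP[/predU1P[//|/no_lt//]|].
by case/predU1P => [->//|/no_lt].
Qed.

End trees.

(** * Functionals on a completion *)

Section functionals.
Context {R : realType}.

Lemma le_eps_linear (x y M : R) :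
  0 <= M -> (forall e, 0 < e -> x <= y + M * e) -> x <= y.
Proof.
move=> M0 xy; apply/ler_addgt0Pr => e e0.
(* The denominator is M + 1 because M may vanish. *)
have M1 : 0 < M + 1 by rewrite ltr_wpDl.
apply: (le_trans (xy (e / (M + 1)) _)); first by rewrite divr_gt0.
rewrite lerD2l mulrCA ler_piMr ?(ltW e0)// ler_pdivrMr// mul1r.
by rewrite lerDl.
Qed.

Lemma completion_approx {V : normedModType R} {E : completeNormedModType R}
    (iota : {linear V -> E}) : completion iota ->
  forall x e, 0 < e -> exists v, `|x - iota v| < e.
Proof.
move=> [_ dn] x e e0.
have [|y [xy [v _ vy]]] := dn (ball x e) _ (ball_open x e).
  by exists x; exact: ballxx.
by exists v; rewrite vy; move: xy; rewrite -ball_normE.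
Qed.

(** The McShane formula G x = sup_v (l v - |x - iota v|) extends the 1-Lipschitz
    function l without choosing approximating sequences. The estimate
    |G x - l v| <= |x - iota v| then carries over linearity from the dense range. *)
Lemma linear_extension {V : normedModType R} {E : completeNormedModType R}
    (iota : {linear V -> E}) (l : V -> R) : completion iota ->
  (forall a v w, l (a *: v + w) = a * l v + l w) ->
  (forall v, `|l v| <= `|v|) ->
  exists G : dual E, forall v, G (iota v) = l v.
Proof.
move=> iota_c l_lin l_le; have iota_iso := iota_c.1.
have lB v w : l v - l w <= `|v - w|.
  have <- : l (v - w) = l v - l w by rewrite addrC -scaleN1r l_lin mulN1r addrC.
  exact: le_trans (ler_norm _) (l_le _).
pose S x := [set l v - `|x - iota v| | v in setT].
pose G x := sup (S x).
have S_ub x v : ubound (S x) (l v + `|x - iota v|).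
  move=> _ [w _ <-]; rewrite lerBlDr -addrA -lerBlDl (le_trans (lB w v))//.
  rewrite -iota_iso linearB distrC (le_trans (ler_distD x _ _))//.
  by rewrite (distrC (iota v)).
have G_near x v : `|G x - l v| <= `|x - iota v|.
  rewrite ler_distl; apply/andP; split.
    by apply: ub_le_sup; [exists (l v + `|x - iota v|); exact: S_ub|exists v].
  by apply: ge_sup; [exists (l v - `|x - iota v|), v|exact: S_ub].
have G_iota v : G (iota v) = l v.
  apply/eqP; rewrite -subr_eq0 -normr_le0.
  by rewrite (le_trans (G_near _ v))// subrr normr0.
have G_lin : linear (G : E -> R^o).
  move=> a x y; apply/eqP; rewrite -subr_eq0 -normr_le0.
  apply: (@le_eps_linear _ _ (2 * (`|a| + 1))) => [|e e0].
    by rewrite mulr_ge0// addr_ge0.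
  have [v xv] := completion_approx _ iota_c x _ e0.
  have [w yw] := completion_approx _ iota_c y _ e0.
  rewrite add0r.
  have -> : G (a *: x + y) - (a *: G x + G y : R^o) =
      (G (a *: x + y) - l (a *: v + w)) - a * (G x - l v) - (G y - l w).
    rewrite l_lin -[a *: G x]/(a * G x); ring.
  apply: (le_trans (ler_normB _ _)).
  apply: (le_trans (lerD (ler_normB _ _) (lexx _))).
  have h1 : `|G (a *: x + y) - l (a *: v + w)| <= `|a| * e + e.
    apply: (le_trans (G_near _ _)).
    have -> : a *: x + y - iota (a *: v + w) = a *: (x - iota v) + (y - iota w).
      by rewrite linearP scalerBr opprD addrACA.
    apply: (le_trans (ler_normD _ _)); rewrite normrZ lerD ?(ltW yw)//.
    by rewrite ler_wpM2l// ltW.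
  have h2 : `|a * (G x - l v)| <= `|a| * e.
    by rewrite normrM ler_wpM2l// (le_trans (G_near _ _))// ltW.
  have h3 : `|G y - l w| <= e by rewrite (le_trans (G_near _ _))// ltW.
  apply: (le_trans (lerD (lerD h1 h2) h3)).
  by rewrite le_eqVlt; apply/orP; left; apply/eqP; ring.
have l0 : l 0 = 0 by apply/eqP; rewrite -normr_le0 (le_trans (l_le _))// normr0.
have G_le x : `|G x| <= `|x|.
  by have := G_near x 0; rewrite l0 (linear0 iota) !subr0.
pose F : {linear E -> R^o} :=
  HB.pack (G : E -> R^o) (GRing.isLinear.Build R E R^o *:%R G G_lin).
have F_cont : continuous (G : E -> R^o).
  apply: (@bounded_linear_continuous _ _ _ F); apply/linear_boundedP.
  near=> M => x; apply: (le_trans (G_le x)).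
  by rewrite -[leLHS]mul1r ler_wpM2r.
have Gc : (G : E -> R^o) \in @continuous_linear R E by apply/asboolP.
by exists (Dual Gc).
Unshelve. all: end_near. Qed.

Lemma dual_apply_le {E : normedModType R} (G : dual E) x :
  `|G x| <= `|G| * `|x|.
Proof.
have [->|x0] := eqVneq x 0.
  by rewrite -(scale0r 0) dualZ mul0r normr0 mulr_ge0.
have nx : 0 < `|x| by rewrite normr_gt0.
rewrite -ler_pdivrMr// mulrC -[X in X * _](ger0_norm (ltW _)) ?invr_gt0//.
rewrite -normrM -dualZ dual_norm_ub// normrZ normfV normr_id mulVf//.
by rewrite gt_eqF.
Qed.

Lemma dual_norm_le_dense {V : normedModType R} {E : completeNormedModType R}
    (iota : {linear V -> E}) (G : dual E) (C : R) : completion iota -> 0 <= C ->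
  (forall v, `|G (iota v)| <= C * `|v|) -> `|G| <= C.
Proof.
move=> iota_c C0 GC; apply: (ge_sup (unit_values_nonempty _)) => _ [x /= x1 <-].
apply: (@le_eps_linear _ _ (C + `|G|)) => [|e e0]; first by rewrite addr_ge0.
have [v xv] := completion_approx _ iota_c x _ e0.
have -> : G x = G (x - iota v) + G (iota v).
  have [Gl _] := dualP G.
  by rewrite -[x in LHS](subrK (iota v)) -[x - iota v]scale1r Gl !scale1r.
apply: (le_trans (ler_normD _ _)).
have h1 : `|G (x - iota v)| <= `|G| * e.
  by rewrite (le_trans (dual_apply_le _ _))// ler_wpM2l// ltW.
have h2 : `|G (iota v)| <= C * (1 + e).
  rewrite (le_trans (GC v))// ler_wpM2l// -iota_c.1.
  rewrite -[iota v](subrK x) addrC (le_trans (ler_normD _ _))// lerD//.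
  by rewrite distrC ltW.
apply: (le_trans (lerD h1 h2)); rewrite le_eqVlt; apply/orP; left.
by apply/eqP; ring.
Qed.

(** By Lagrange's identity. *)
Lemma cauchy_schwarz_sum n (a b : 'I_n -> R) :
  `|\sum_(i < n) a i * b i| <=
  Num.sqrt (\sum_(i < n) a i ^+ 2) * Num.sqrt (\sum_(i < n) b i ^+ 2).
Proof.
set A := \sum_(i < n) a i ^+ 2; set B := \sum_(i < n) b i ^+ 2.
set P := \sum_(i < n) a i * b i.
have A0 : 0 <= A by apply: sumr_ge0 => i _; exact: sqr_ge0.
have B0 : 0 <= B by apply: sumr_ge0 => i _; exact: sqr_ge0.
rewrite -sqrtrM// -sqrtr_sqr ler_wsqrtr//.
have H : 2 * (A * B - P ^+ 2) =
    \sum_(i < n) \sum_(j < n) (a i * b j - a j * b i) ^+ 2.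
  have -> : 2 * (A * B - P ^+ 2) = A * B + B * A - 2 * (P * P) by ring.
  rewrite {1 2}/A {1 2}/B {1}/P !mulr_suml.
  rewrite [in X in _ - X]mulr_sumr -sumrN -!big_split/=.
  apply: eq_bigr => i _; rewrite /A /B /P !mulr_sumr -sumrN -!big_split/=.
  by apply: eq_bigr => j _; ring.
rewrite -subr_ge0 -(pmulr_rge0 _ (_ : 0 < 2))// H.
by apply: sumr_ge0 => i _; apply: sumr_ge0 => j _; exact: sqr_ge0.
Qed.

End functionals.

(** * Averages and weak limits under an equivalent norm *)

Section renorming.
Context {R : realType} {X : normedModType R}.

(** n y is the sum of x_0, ..., x_(n-1) minus that of the x_k - y, so
    n (N y - b) = O(sqrt n). *)
Lemma averaging_bound (N : X -> R) (x : nat -> X) (y : X) (M b : R) :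
  equivalent_norm N -> (forall k, N (x k) <= b) ->
  (forall n, `|\sum_(k < n) (x k - y)| <= M * Num.sqrt n%:R) -> N y <= b.
Proof.
move=> [N_add N_hom [c [C [c0 C0 N_le]]]] xb x_avg.
rewrite leNgt; apply/negP => by_; set e := N y - b.
have e0 : 0 < e by rewrite subr_gt0.
have N0 : N 0 = 0 by have := N_hom 0 0; rewrite scale0r normr0 mul0r.
have N_sum n : N (\sum_(k < n) x k) <= b *+ n.
  elim: n => [|n IH]; first by rewrite big_ord0 N0.
  by rewrite big_ord_recr/= mulrSr (le_trans (N_add _ _))// lerD.
have bound n : e * n%:R <= C * M * Num.sqrt n%:R.
  have : N (n%:R *: y) <= b *+ n + C * (M * Num.sqrt n%:R).
    have -> : n%:R *: y = \sum_(k < n) x k + (-1) *: \sum_(k < n) (x k - y).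
      rewrite sumrB sumr_const card_ord scaleN1r opprB addrC subrK.
      by rewrite scaler_nat.
    rewrite (le_trans (N_add _ _))// lerD// N_hom normrN1 mul1r.
    have /andP[_ /le_trans] := N_le (\sum_(k < n) (x k - y)); apply.
    by rewrite ler_pM2l.
  rewrite N_hom ger0_norm// -mulr_natr /e; lra.
have bound2 n : e ^+ 2 * n%:R <= (C * M) ^+ 2.
  case: n => [|n]; first by rewrite mulr0 sqr_ge0.
  have r0 : 0 < Num.sqrt (n.+1%:R : R) by rewrite sqrtr_gt0.
  have rr : (n.+1%:R : R) = Num.sqrt n.+1%:R * Num.sqrt n.+1%:R.
    by rewrite -expr2 sqr_sqrtr.
  have := bound n.+1; rewrite {1}rr mulrA ler_pM2r// => h.
  rewrite rr -[X in _ * X]expr2 -exprMn ler_sqr ?nnegrE//.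
    by rewrite mulr_ge0// ltW.
  by rewrite (le_trans _ h)// mulr_ge0// ltW.
have e20 : 0 < e ^+ 2 by rewrite exprn_gt0.
have := bound2 (Num.bound ((C * M) ^+ 2 / e ^+ 2)).
rewrite mulrC -ler_pdivlMr// leNgt => /negP; apply.
by apply: archi_boundP; rewrite divr_ge0// ?sqr_ge0// ltW.
Qed.

Lemma dual_sum (I : Type) (r : seq I) (G : I -> dual X) x :
  (\sum_(i <- r) G i) x = \sum_(i <- r) (G i x : R).
Proof. exact: (big_morph (fun F : dual X => F x : R)). Qed.

Lemma dual_linear (G : dual X) a x y : G (a *: x + y) = a * G x + G y.
Proof. by have [Gl _] := dualP G; rewrite Gl. Qed.

Lemma dual_apply_sum n (G : dual X) (c : 'I_n -> R) (x : 'I_n -> X) :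
  G (\sum_(i < n) c i *: x i) = \sum_(i < n) c i * G (x i).
Proof.
have G0 : G 0 = 0 by rewrite -(scale0r 0) dualZ mul0r.
elim: n c x => [|n IH] c x; first by rewrite !big_ord0.
by rewrite !big_ord_recl/= dual_linear IH.
Qed.

(** With c_k = phi z_k, the sum of the first n squares c_k^2 is phi evaluated at
    sum_k c_k z_k, at most |phi| times its own square root; so the series of the
    c_k^2 is bounded by |phi|^2. *)
Lemma weakly_null_l2 (z : nat -> X) :
  (forall n (c : nat -> R),
    `|\sum_(k < n) c k *: z k| <= Num.sqrt (\sum_(k < n) c k ^+ 2)) ->
  forall phi : dual X, phi (z n) @[n --> \oo] --> (0 : R).
Proof.
move=> z_l2 phi; pose c n : R := phi (z n).
have bessel n : \sum_(k < n) c k ^+ 2 <= `|phi| ^+ 2.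
  set S := \sum_(k < n) _.
  have S0 : 0 <= S by apply: sumr_ge0 => k _; exact: sqr_ge0.
  have SE : S = phi (\sum_(k < n) c k *: z k).
    by rewrite dual_apply_sum; apply: eq_bigr => k _; rewrite expr2.
  have : Num.sqrt S * Num.sqrt S <= `|phi| * Num.sqrt S.
    rewrite -expr2 sqr_sqrtr// {1}SE (le_trans (ler_norm _))//.
    rewrite (le_trans (dual_apply_le _ _))// ler_wpM2l//; exact: z_l2.
  have [S1|S1] := eqVneq S 0; first by rewrite S1 sqr_ge0.
  have r0 : 0 < Num.sqrt S by rewrite sqrtr_gt0 lt0r S1.
  rewrite ler_pM2r// => h; rewrite -(sqr_sqrtr S0) ler_sqr ?nnegrE//.
have : cvgn (series (fun n => c n ^+ 2 : R)).
  apply: nondecreasing_is_cvgn.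
    by apply: nondecreasing_series => n _ _; exact: sqr_ge0.
  exists (`|phi| ^+ 2) => _ [n _ <-]; rewrite /series/= big_mkord.
  exact: bessel.
move=> /cvg_series_cvg_0 c2_0; apply/cvgrPdist_lt => e e0.
move/cvgrPdist_lt : c2_0 => /(_ (e ^+ 2)); rewrite exprn_gt0// => /(_ isT).
apply: filterS => n; rewrite !sub0r !normrN normrX ltr_pXn2r// nnegrE//.
exact: ltW.
Qed.

Lemma weak_cvg (x : nat -> X) (y : X) :
  (forall phi : dual X, phi (x n) @[n --> \oo] --> (phi y : R)) ->
  x @ \oo --> (y : weak_space X).
Proof.
move=> xy; apply/cvg_sup => phi U [_ [[V oV <-] Vy] VU].
by apply: (filterS VU); apply: (xy phi); exact: open_nbhs_nbhs.
Qed.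

End renorming.

(** * Branch functionals on the James tree space *)

Section JT.
Context {R : realType} {d : Order.disp_t} {T : porderType d}.
Context {JT : completeNormedModType R} (iota : {linear c00 R T -> JT}).
Hypothesis T_tree : is_tree T.
Hypothesis iota_c : completion iota.

Lemma segment_functional (A : set T) : segment A ->
  exists G : dual JT, forall f, G (iota f) = \sum_(t \in A) (f t : R).
Proof.
move=> A_seg.
apply: (linear_extension iota (fun f => \sum_(t \in A) (f t : R)) iota_c).
  by move=> a f g; rewrite sum_c00D sum_c00Z.
move=> f; have ds : disjoint_segments (fun _ : 'I_1 => A).
  by split=> // i j _ _ _; rewrite !ord1.
by have := JT_sums_le f ds; rewrite /l2_of_sums big_ord1 sqrtr_sqr.
Qed.

Definition branch_functionals (gamma : T -> dual JT) := forall t f,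
  gamma t (iota f) = \sum_(s \in [set s | (s <= t)%O]) (f s : R).

Lemma branch_functionals_exist : exists gamma, branch_functionals gamma.
Proof.
have /choice[gamma gammaP] : forall t, exists G : dual JT, forall f,
    G (iota f) = \sum_(s \in [set s | (s <= t)%O]) (f s : R).
  by move=> t; apply: segment_functional; exact: segment_initial.
by exists gamma.
Qed.

Lemma indicator_finsupp t : (fun s => (s == t)%:R : R^o) \in @finsupp_fun R d T.
Proof.
apply/asboolP; apply: (sub_finite_set _ (finite_set1 t)) => s /=.
by case: (eqVneq s t) => // _; rewrite eqxx.
Qed.

Definition unit_node t : c00 R T := C00 (indicator_finsupp t).

Lemma sum_unit_node t (A : set T) :
  \sum_(s \in A) (unit_node t s : R) = (t \in A)%:R.
Proof.
have tP : [set s | unit_node t s != 0] `<=` [set` [:: t]].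
  by move=> s /=; rewrite inE; case: (eqVneq s t) => // _; rewrite eqxx.
by rewrite (sum_c00E _ _ tP)// big_seq1/=; case: ifP; rewrite ?eqxx.
Qed.

Lemma unit_node_norm_le1 t : `|unit_node t| <= 1.
Proof.
apply: (ge_sup (JT_sums_nonempty _)) => _ [n [sigma [[_ tsigma] ->]]].
rewrite /l2_of_sums -[leRHS]sqrtr1 ler_wsqrtr//.
have [[i ti]|nt] := pselect (exists i, sigma i t); last first.
  rewrite big1// => i _; rewrite sum_unit_node memNset ?expr0n// => ti.
  by apply: nt; exists i.
rewrite (bigD1 i)//= sum_unit_node mem_set// expr1n big1 ?addr0// => j ji.
rewrite sum_unit_node memNset ?expr0n// => tj.
by case/negP: ji; apply/eqP; apply: tsigma => //; exists t.
Qed.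

Context (gamma : T -> dual JT) (gammaP : branch_functionals gamma).

Lemma dualB_apply (F G : dual JT) x : (F - G) x = F x - G x.
Proof. by []. Qed.

Lemma branch_sub t u f : (t <= u)%O ->
  (gamma u - gamma t) (iota f) =
    \sum_(s \in [set s | (t < s <= u)%O]) (f s : R).
Proof.
move=> tu; rewrite dualB_apply !gammaP.
have [r [ur fr _]] := c00_common_seq f f.
rewrite !(sum_c00E _ ur fr) -sumrB; apply: eq_bigr => s _.
have memE (P : pred T) : (s \in [set x | P x]) = P s.
  by apply/idP/idP; rewrite inE.
rewrite (memE (fun x => x <= u)%O) (memE (fun x => x <= t)%O).
rewrite (memE (fun x => t < x <= u)%O).
have [st|nst] := boolP (s <= t)%O.
  rewrite (le_trans st tu) subrr (_ : (t < s)%O = false)//.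
  by apply/negbTE/negP => /lt_le_trans /(_ st); rewrite ltxx.
rewrite subr0; have [su|//] := boolP (s <= u)%O; last by rewrite andbF.
have := tree_comparable T_tree _ _ _ tu su.
by rewrite /Order.comparable (negbTE nst) orbF le_eqVlt => /predU1P[ts|->//];
  rewrite ts lexx in nst.
Qed.

Lemma branch_dist_ge1 t s : (t < s)%O -> 1 <= `|gamma s - gamma t|.
Proof.
move=> ts; have := dual_apply_le (gamma s - gamma t) (iota (unit_node s)).
rewrite (branch_sub _ _ _ (ltW ts)) sum_unit_node mem_set ?normr1/=; last first.
  by rewrite ts lexx.
move/le_trans; apply; rewrite ler_piMr// iota_c.1; exact: unit_node_norm_le1.
Qed.

Lemma branch_neq0 t : gamma t != 0.
Proof.
apply/eqP => g0; have := gammaP t (unit_node t).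
have -> : gamma t (iota (unit_node t)) = 0 by rewrite g0.
by rewrite sum_unit_node mem_set//= => /eqP; rewrite eq_sym oner_eq0.
Qed.

(** Pairwise disjoint segments occur together in the supremum that defines the norm
    of JT, so Cauchy-Schwarz bounds combinations of their sum functionals. *)
Lemma fan_l2_estimate n (t : T) (s u : 'I_n -> T) (c : 'I_n -> R) :
  injective s -> (forall i, immediate_succ t (s i)) ->
  (forall i, (s i <= u i)%O) ->
  `|\sum_(i < n) c i *: (gamma (u i) - gamma t)| <=
    Num.sqrt (\sum_(i < n) c i ^+ 2).
Proof.
move=> s_inj s_succ su.
apply: (dual_norm_le_dense iota _ _ iota_c) => [|f]; first exact: sqrtr_ge0.
pose sigma i := [set x | (t < x <= u i)%O].
have ds : disjoint_segments sigma.
  split; first by move=> i; exact: segment_interval.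
  exact: (trivIset_fan T_tree _ t s u).
rewrite dual_sum.
have -> : \sum_(i < n) ((c i *: (gamma (u i) - gamma t)) (iota f) : R) =
    \sum_(i < n) c i * \sum_(x \in sigma i) (f x : R).
  apply: eq_bigr => i _; rewrite -branch_sub//.
  exact: le_trans (ltW (s_succ i).1) (su i).
rewrite (le_trans (cauchy_schwarz_sum _ _ _))// ler_wpM2l//.
exact: JT_sums_le.
Qed.


(** * Equivalent norms are eventually constant on branch functionals *)

Section limit_norm.
Hypothesis T1 : forall t : T, infinite_set [set s | immediate_succ t s].
Hypothesis T2 : forall S : nat -> set T, (forall n, antichain (S n)) ->
  exists t : T, ~ (\bigcup_n down_closure (S n)) t.

Lemma immediate_succ_seq t : exists s : nat -> T,
  injective s /\ forall n, immediate_succ t (s n).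
Proof.
have /infiniteP/card_leP[f] := T1 t.
pose n' n : [set: nat] := SigSub (mem_set (I : [set: nat] n)).
exists (fun n => val (f (n' n))); split=> [m n /val_inj fmn|n].
  by have /(congr1 val) := inj (in_setT (n' m)) (in_setT (n' n)) fmn.
exact: set_valP.
Qed.

(** The candidates whose smallest N-norm is studied. Whole segments, rather than
    the functionals [gamma u] alone, make the infimum a lower bound at the points
    that strict convexity is about. *)
Definition branch_segments t : set (dual JT) :=
  [set x | exists u v l, [/\ (t <= u)%O, (t <= v)%O, 0 <= l <= 1 &
    x = (1 - l) *: gamma u + l *: gamma v]].

(** Competitors chosen above distinct immediate successors of t average out to
    [gamma t]: the fan estimate is used once for each end of the segments. *)
Lemma branch_segment_fan_bound n t (s u v : nat -> T) (l : nat -> R) :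
  injective s -> (forall k, immediate_succ t (s k)) ->
  (forall k, (s k <= u k)%O) -> (forall k, (s k <= v k)%O) ->
  (forall k, 0 <= l k <= 1) ->
  `|\sum_(k < n) ((1 - l k) *: gamma (u k) + l k *: gamma (v k) - gamma t)|
    <= 2 * Num.sqrt n%:R.
Proof.
move=> s_inj s_succ su sv l01.
have -> : \sum_(k < n) ((1 - l k) *: gamma (u k) + l k *: gamma (v k) - gamma t)
    = \sum_(k < n) (1 - l k) *: (gamma (u k) - gamma t) +
      \sum_(k < n) l k *: (gamma (v k) - gamma t).
  rewrite -big_split/=; apply: eq_bigr => k _.
  by rewrite !scalerBr addrACA -opprD -scalerDl subrK scale1r.
have ord_inj' : injective (fun k : 'I_n => s k) by move=> i j /s_inj/val_inj.
have sq_le1 (c : nat -> R) : (forall k, 0 <= c k <= 1) ->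
    Num.sqrt (\sum_(k < n) c k ^+ 2) <= Num.sqrt n%:R.
  move=> c01; rewrite ler_wsqrtr// -[X in _ <= X%:R]card_ord -sumr_const.
  rewrite ler_sum// => k _.
  by have /andP[c0 c1] := c01 k; rewrite expr_le1.
rewrite (le_trans (ler_normD _ _))// mulr_natl mulr2n lerD//.
  have := fan_l2_estimate n t _ (fun k => u k) (fun k => 1 - l k) ord_inj'
      (fun k => s_succ k) (fun k => su k).
    move=> /le_trans; apply; apply: (sq_le1 (fun k => 1 - l k)) => k.
    have /andP[? ?] := l01 k.
  by apply/andP; split; lra.
have := fan_l2_estimate n t _ (fun k => v k) (fun k => l k) ord_inj'
  (fun k => s_succ k) (fun k => sv k).
by move=> /le_trans; apply; exact: sq_le1.
Qed.

(** The infimum of N over [branch_segments t] grows with t, so it is constant above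
    some t0; averaging near-minimizers taken above the successors of t shows that
    [gamma t] itself attains it. *)
Lemma branch_norm_stabilizes (N : dual JT -> R) : equivalent_norm N ->
  exists t a, forall u v l, (t <= u)%O -> (u <= v)%O -> 0 <= l <= 1 ->
    N ((1 - l) *: gamma u + l *: gamma v) = a.
Proof.
move=> N_eqv; have [N_add N_hom [c [C [c0 C0 N_le]]]] := N_eqv.
have N_ge0 x : 0 <= N x.
  by have /andP[+ _] := N_le x; apply: le_trans; rewrite mulr_ge0// ltW.
pose mu t : R := inf (N @` branch_segments t).
have in_segments t u v l : (t <= u)%O -> (t <= v)%O -> 0 <= l <= 1 ->
    branch_segments t ((1 - l) *: gamma u + l *: gamma v).
  by move=> *; exists u, v, l.
have gamma_in t : branch_segments t (gamma t).
  have := in_segments t t t 0 (lexx t) (lexx t).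
  by rewrite lexx ler01 subr0 scale1r scale0r addr0; apply.
have N_lb t : has_lbound (N @` branch_segments t).
  by exists 0 => _ [x _ <-].
have N_inf t : has_inf (N @` branch_segments t).
  by split=> //; exists (N (gamma t)), (gamma t).
have mu_le t x : branch_segments t x -> mu t <= N x.
  by move=> tx; apply: ge_inf => //; exists x.
have mu_nd : {homo mu : s t / (s <= t)%O >-> s <= t}.
  move=> s t st; apply: lb_le_inf; first exact: (N_inf t).1.
  move=> _ [_ [u [v [l [tu tv l01 ->]]]] <-]; apply: mu_le.
  by apply: in_segments => //; exact: le_trans st _.
have [t0 mu_t0] := nondecreasing_stabilizes R T_tree T2 mu mu_nd.
have gamma_le t : (t0 <= t)%O -> N (gamma t) <= mu t0.
  move=> t0t; apply/ler_addgt0Pr => e e0.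
  have [s [s_inj s_succ]] := immediate_succ_seq t.
  have /choice[p pP] : forall k, exists p : T * T * R,
      [/\ (s k <= p.1.1)%O, (s k <= p.1.2)%O, 0 <= p.2 <= 1 &
       N ((1 - p.2) *: gamma p.1.1 + p.2 *: gamma p.1.2) <= mu t0 + e].
    move=> k; have t0s : (t0 <= s k)%O.
      by rewrite (le_trans t0t)// ltW// (s_succ k).1.
    have [_ [_ [u [v [l [su sv l01 ->]]]] <-]] := inf_adherent e0 (N_inf (s k)).
    rewrite -/(mu (s k)) mu_t0// => /ltW Nle.
    by exists (u, v, l).
  apply: (averaging_bound N
    (fun k => (1 - (p k).2) *: gamma (p k).1.1 + (p k).2 *: gamma (p k).1.2)
    (gamma t) 2) => // [k|n].
    by case: (pP k).
  apply: (branch_segment_fan_bound n t s (fun k => (p k).1.1)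
    (fun k => (p k).1.2) (fun k => (p k).2)) => // k; by case: (pP k).
exists t0, (mu t0) => u v l t0u uv l01.
apply/eqP; rewrite eq_le; apply/andP; split.
  have /andP[l0 l1] := l01.
  rewrite (le_trans (N_add _ _))// !N_hom !ger0_norm ?subr_ge0//.
  have -> : mu t0 = (1 - l) * mu t0 + l * mu t0 by ring.
  rewrite lerD// ler_wpM2l ?subr_ge0// gamma_le//.
  exact: le_trans uv.
by rewrite -(mu_t0 u)//; apply: mu_le; apply: in_segments.
Qed.

Lemma normalized_branches (N : dual JT -> R) : equivalent_norm N ->
  exists t (a : R), 0 < a /\
    forall u v l, (t <= u)%O -> (u <= v)%O -> 0 <= l <= 1 ->
    sphere N ((1 - l) *: (a *: gamma u) + l *: (a *: gamma v)).
Proof.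
move=> N_eqv; have [t [a aP]] := branch_norm_stabilizes N N_eqv.
have [_ N_hom [c [C [c0 C0 N_le]]]] := N_eqv.
have Nt : N (gamma t) = a.
  have := aP t t 0 (lexx t) (lexx t).
  by rewrite lexx ler01 subr0 scale1r scale0r addr0; apply.
have a0 : 0 < a.
  rewrite -Nt; have /andP[+ _] := N_le (gamma t); apply: lt_le_trans.
  by rewrite mulr_gt0// normr_gt0 branch_neq0.
exists t, a^-1; split=> [|u v l tu uv l01]; first by rewrite invr_gt0.
rewrite /sphere/= !scalerA ![_ * a^-1]mulrC -!scalerA -scalerDr N_hom aP//.
by rewrite gtr0_norm ?invr_gt0// mulVf// gt_eqF.
Qed.

Lemma not_strictly_convex (N : dual JT -> R) :
  equivalent_norm N -> ~ strictly_convex N.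
Proof.
move=> N_eqv N_sc; have [t [a [a0 aP]]] := normalized_branches N N_eqv.
have [s [_ s_succ]] := immediate_succ_seq t.
have ts : (t < s 0%N)%O := (s_succ 0%N).1.
have /N_sc/(scalerI (lt0r_neq0 a0)) gg : forall l, 0 <= l <= 1 ->
    sphere N ((1 - l) *: (a *: gamma t) + l *: (a *: gamma (s 0%N))).
  by move=> l l01; apply: aP => //; exact: ltW.
by have := branch_dist_ge1 t _ ts; rewrite gg subrr normr0 ler10.
Qed.

(** The trace on the sphere of a small ball around the normalized [gamma t] is not
    relatively weakly open: it misses the normalized [gamma (s k)], which converge weakly to
    its centre. *)
Lemma not_kadec (N : dual JT -> R) : equivalent_norm N -> ~ kadec N.
Proof.
move=> N_eqv N_k; have [t [a [a0 aP]]] := normalized_branches N N_eqv.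
have on_sphere u : (t <= u)%O -> sphere N (a *: gamma u).
  move=> tu; have := aP u u 0 tu (lexx u).
  by rewrite lexx ler01 subr0 scale1r scale0r addr0; apply.
have [s [s_inj s_succ]] := immediate_succ_seq t.
have ts k : (t < s k)%O := (s_succ k).1.
have g_cvg : (fun k => a *: gamma (s k)) @ \oo -->
    ((a *: gamma t : dual JT) : weak_space (dual JT)).
  apply: weak_cvg => phi.
  have := weakly_null_l2 (fun k => gamma (s k) - gamma t) _ phi.
  move=> z0.
  have -> : (fun n => phi (a *: gamma (s n)) : R) =
      (fun n => a * phi (gamma (s n) - gamma t) + phi (a *: gamma t) : R).
    by apply/funext => n; rewrite -dual_linear scalerBr subrK.
  rewrite -[X in _ --> X]add0r; apply: cvgD; last exact: cvg_cst.
  rewrite -(mulr0 a); apply: cvgMr; apply: z0 => n c.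
  by apply: (fan_l2_estimate n t (fun k => s k) (fun k => s k) (fun k => c k)) =>
    // i j /s_inj/val_inj.
(* By [branch_dist_ge1], the points [a *: gamma (s k)] are at distance at least a
   from [a *: gamma t]. *)
pose A := sphere N `&` ball (a *: gamma t) a.
have [_ /(_ _)[]] := N_k A (@subIsetl _ _ _).
  by exists (ball (a *: gamma t) a) => //; exact: ball_open.
move=> U oU AU.
have Ut : U (a *: gamma t).
  have : A (a *: gamma t) by split; [exact: on_sphere|exact: ballxx].
  by rewrite AU => -[].
have [k Uk] : exists k, U (a *: gamma (s k)).
  have : \forall k \near \oo, U (a *: gamma (s k)).
    by apply: g_cvg; exact: open_nbhs_nbhs.
  by case=> n _ /(_ n (leqnn n)); exists n.
have : A (a *: gamma (s k)).
  by rewrite AU; split=> //; apply: on_sphere; exact: ltW.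
move=> [_]; rewrite -ball_normE/= -scalerBr normrZ gtr0_norm// gtr_pMr//.
by rewrite distrC ltNge branch_dist_ge1.
Qed.

End limit_norm.
End JT.

Theorem theorem9 (R : realType) (d : Order.disp_t) (T : porderType d)
    (JT : completeNormedModType R) (iota : {linear c00 R T -> JT})
    (T_tree : is_tree T)
    (JT_completion : completion iota)
    (T1 : forall t : T, infinite_set [set s | immediate_succ t s])
    (T2 : forall S : nat -> set T, (forall n, antichain (S n)) ->
      exists t : T, ~ (\bigcup_n down_closure (S n)) t) :
  ~ (exists N : dual JT -> R, equivalent_norm N /\ strictly_convex N) /\
  ~ (exists N : dual JT -> R, equivalent_norm N /\ kadec N).
Proof.
have [gamma gammaP] := branch_functionals_exist iota T_tree JT_completion.
split=> -[N [N_eqv]].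
- exact: (not_strictly_convex iota T_tree JT_completion gamma gammaP T1 T2).
- exact: (not_kadec iota T_tree JT_completion gamma gammaP T1 T2).
Qed.
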